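(* For every integer $n\ge 0$, $$B_{n}^{L}=\frac{1}{e}\sum_{k=0}^{\infty}\frac{\langle k\rangle_{n}}{k!}.$$
   Context: The rising factorial is $\langle x\rangle_0=1$ and $\langle x\rangle_n=x(x+1)\cdots(x+n-1)$ for $n\ge 1$. For integers $n,k\ge 0$, the unsigned Lah number $L(n,k)$ is the number of ways a set of $n$ elements can be partitioned into $k$ nonempty linearly ordered subsets (so $L(0,0)=1$, $L(n,0)=0$ for $n\ge 1$, $L(n,k)=0$ for $k>n$, and $L(n,k)=\binom{n-1}{k-1}\frac{n!}{k!}$ for $n\ge k\ge 1$). The $n$-th Lah-Bell number is $B_n^L=\sum_{k=0}^n L(n,k)$. *)

(* Defs.v *)
From HB Require Import structures.
From mathcomp Require Import all_boot all_order all_algebra.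

Set Implicit Arguments.
Unset Strict Implicit.
Unset Printing Implicit Defensive.

Import GRing.Theory.

Definition rising_factorial (R : pzSemiRingType) (x : R) (n : nat) : R :=
  (\prod_(i < n) (x + i%:R))%R.

Definition linear_order_on (T : finType) (B : {set T}) (r : rel T) : bool :=
  [&& [forall x in B, r x x],
      [forall x in B, forall y in B, (r x y && r y x) ==> (x == y)],
      [forall x in B, forall y in B, forall z in B,
         (r x y && r y z) ==> r x z] &
      [forall x in B, forall y in B, r x y || r y x]].

(* A partition of T into nonempty linearly ordered subsets is a pair (P, r)
   where P is the set of blocks (nonempty by definition of [partition]) and r,
   given by its graph, is the disjoint union of the linear orders chosen on the
   blocks. Forbidding r to relate elements of different blocks makes r determined
   by these orders, so that each ordered partition is represented only once. *)
Definition ordered_partition (T : finType) (P : {set {set T}})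
    (r : {set T * T}) : bool :=
  [&& partition P [set: T],
      [forall B in P, linear_order_on B [rel x y | (x, y) \in r]] &
      [forall p in r, exists B in P, (p.1 \in B) && (p.2 \in B)]].

Definition lah (n k : nat) : nat :=
  #|[set Pr : {set {set 'I_n}} * {set 'I_n * 'I_n} |
      ordered_partition Pr.1 Pr.2 & #|Pr.1| == k]|.

Definition lah_bell (n : nat) : nat := \sum_(0 <= k < n.+1) lah n k.

(* Main.v *)
Require Import Defs.
From HB Require Import structures.
From mathcomp Require Import all_boot all_order all_algebra.
From mathcomp Require Import fingroup perm.
From mathcomp Require Import all_classical all_reals all_analysis.
Import Order.TTheory GRing.Theory Num.Theory.
Import numFieldNormedType.Exports.

(** The rising factorial m(m+1)...(m+n-1) is the sum over k of lah n k times the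
    falling factorial m(m-1)...(m-k+1). Both sides count the pairs (f, r) where f
    is a colouring of n elements by m colours and r consists of a linear order on
    each nonempty colour class:
    - the colour classes with their orders form an ordered partition, and those
      with k blocks come from as many colourings as there are injections of the
      blocks into the colours ([card_fibre_ordered_by_kernel]);
    - listing the elements by increasing colour, and each class along its order,
      gives a permutation of the n elements together with the weakly increasing
      word of their colours, and nothing is lost since the word shows where one
      class stops and the next one starts. There are n! permutations, and
      m(m+1)...(m+n-1)/n! weakly increasing words
      ([card_fibre_ordered_by_word]).

    Dividing this identity by m! and summing over m gives the theorem, because
    each falling factorial contributes the same constant: the sum over m of
    m(m-1)...(m-k+1)/m! is the exponential series at 1 shifted by k places, so
    it equals e for every k ([cvg_series_ffact]). *)

Set Implicit Arguments.
Unset Strict Implicit.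
Unset Printing Implicit Defensive.

(** * Ordered partitions as kernels of maps with ordered fibres *)

Section OrderedFibres.
Variables (T : finType) (U : eqType).
Implicit Types (f : T -> U) (r : {set T * T}).

(** Equivalently, [r] is the disjoint union of one linear order on each nonempty
    fibre of [f]: the first clause at [x = y] gives reflexivity, its left-to-right
    half totality on fibres, its right-to-left half incomparability across fibres.
    In this form the partition into fibres need not be mentioned. *)
Definition fibre_ordered f r : bool :=
  [&& [forall x, forall y, (f x == f y) == ((x, y) \in r) || ((y, x) \in r)],
      [forall x, forall y, ((x, y) \in r) && ((y, x) \in r) ==> (x == y)] &
      [forall x, forall y, forall z,
        ((x, y) \in r) && ((y, z) \in r) ==> ((x, z) \in r)]].

Lemma fibre_orderedP f r :
  reflect [/\ forall x y, (f x == f y) = ((x, y) \in r) || ((y, x) \in r),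
              forall x y, (x, y) \in r -> (y, x) \in r -> x = y &
              forall x y z, (x, y) \in r -> (y, z) \in r -> (x, z) \in r]
          (fibre_ordered f r).
Proof.
apply: (iffP and3P) => [[tot asym trans]|[tot asym trans]]; split.
- by move=> x y; move/forallP/(_ x)/forallP/(_ y)/eqP: tot.
- move=> x y xy yx; apply/eqP.
  by move/forallP/(_ x)/forallP/(_ y)/implyP: asym; apply; rewrite xy.
- move=> x y z xy yz.
  move/forallP/(_ x)/forallP/(_ y)/forallP/(_ z)/implyP: trans; apply.
  by rewrite xy.
- by apply/forallP => x; apply/forallP => y; rewrite tot.
- apply/forallP => x; apply/forallP => y; apply/implyP => /andP[xy yx].
  exact/eqP/asym.
- apply/forallP => x; apply/forallP => y; apply/forallP => z.
  by apply/implyP => /andP[]; apply: trans.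
Qed.

Lemma mem_preim_block f (B : {set T}) x y :
  B \in preim_partition f [set: T] -> x \in B -> (y \in B) = (f x == f y).
Proof. by case/imsetP => z _ ->; rewrite !inE /= => /eqP ->. Qed.

(** This is what lets a pair made of an ordered partition and an injective
    colouring of its blocks be replaced by a pair [(f, r)], in which the partition
    is only implicit as the kernel of [f]. *)
Lemma ordered_partition_preim f r :
  ordered_partition (preim_partition f [set: T]) r = fibre_ordered f r.
Proof.
pose blk x := [set y in [set: T] | f x == f y].
have blkP x : blk x \in preim_partition f [set: T] by apply: imset_f.
have in_blk x y : (y \in blk x) = (f x == f y) by rewrite !inE.
apply/and3P/fibre_orderedP => [[_ lin dis]|[tot asym trans]].
- have eqf x y : (x, y) \in r -> f x = f y.
    move=> xy; move/forallP/(_ (x, y)): dis; rewrite xy /=.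
    case/existsP => B /and3P[BP xB yB].
    by apply/eqP; rewrite -(mem_preim_block _ BP).
  have linx x : linear_order_on (blk x) [rel x y | (x, y) \in r].
    by move/forallP/(_ (blk x)): lin; rewrite blkP.
  split=> [x y|x y xy yx|x y z xy yz].
  + apply/idP/orP => [fxy|[/eqf->|/eqf->]//].
    case/and4P: (linx x) => _ _ _ /forallP/(_ x); rewrite in_blk eqxx /=.
    by move=> /forallP/(_ y); rewrite in_blk fxy => /orP.
  + case/and4P: (linx x) => _ /forallP/(_ x) + _ _; rewrite in_blk eqxx /=.
    move=> /forallP/(_ y); rewrite in_blk (eqf _ _ xy) eqxx /= xy yx.
    by move/eqP.
  + case/and4P: (linx x) => _ _ /forallP/(_ x) + _; rewrite in_blk eqxx /=.
    move=> /forallP/(_ y); rewrite in_blk (eqf _ _ xy) eqxx /=.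
    move=> /forallP/(_ z); rewrite in_blk (eqf _ _ xy) (eqf _ _ yz) eqxx /=.
    by rewrite xy yz.
- split; first exact: preim_partitionP.
  + apply/forallP => B; apply/implyP => BP; apply/and4P; split.
    * apply/forallP => x; apply/implyP => xB /=.
      by have := tot x x; rewrite eqxx orbb.
    * apply/forallP => x; apply/implyP => xB.
      apply/forallP => y; apply/implyP => yB.
      by apply/implyP => /andP[/= xy yx]; apply/eqP/asym.
    * apply/forallP => x; apply/implyP => xB.
      apply/forallP => y; apply/implyP => yB.
      apply/forallP => z; apply/implyP => zB.
      by apply/implyP => /andP[/=]; apply: trans.
    * apply/forallP => x; apply/implyP => xB.
      apply/forallP => y; apply/implyP => yB /=.
      by rewrite -tot -(mem_preim_block _ BP).
  + apply/forallP => -[x y]; apply/implyP => xy.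
    apply/existsP; exists (blk x); rewrite blkP /= !in_blk eqxx /=.
    by rewrite tot xy.
Qed.

End OrderedFibres.

(** A map with kernel [P] factors uniquely as the projection onto the blocks of
    [P] followed by an injection of the set of blocks into [U]. *)
Lemma card_ffun_kernel (T U : finType) (P : {set {set T}}) :
  finset.partition P [set: T] ->
  #|[set f : {ffun T -> U} | preim_partition f [set: T] == P]| = #|U| ^_ #|P|.
Proof.
move=> partP; have trivP := partition_trivIset partP.
have covP x : x \in finset.cover P by rewrite (cover_partition partP) inE.
pose blk x : {B | B \in P} := Sub (finset.pblock P x) (pblock_mem (covP x)).
have eq_blk x y : (blk x == blk y) = (y \in finset.pblock P x).
  by rewrite -val_eqE /= eq_pblock.
have elt (B : {B | B \in P}) : exists x, blk x == B.
  have BP := valP B.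
  have /set0Pn[x xB] : val B != finset.set0 by apply: partition_neq0 partP BP.
  by exists x; rewrite -val_eqE /= (def_pblock trivP BP xB).
pose pt B := xchoose (elt B).
have ptK B : blk (pt B) = B by apply/eqP/(xchooseP (elt B)).
pose h (c : {ffun {B | B \in P} -> U}) := [ffun x => c (blk x)].
have h_inj : injective h.
  move=> c d /ffunP hcd; apply/ffunP => B.
  by have := hcd (pt B); rewrite !ffunE ptK.
have -> : #|P| = #|{: {B | B \in P}}| by rewrite card_sig.
rewrite -card_inj_ffuns -(card_imset _ h_inj); apply: eq_card => f.
rewrite inE; apply/eqP/imsetP => [kerf|[c]].
- have kerfE x y : (y \in finset.pblock P x) = (f x == f y).
    rewrite -kerf pblock_equivalence_partition ?inE //.
    by split=> [|/eqP->].
  exists [ffun B => f (pt B)].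
    rewrite inE; apply/injectiveP => B C; rewrite !ffunE => /eqP.
    by rewrite -kerfE -eq_blk !ptK => /eqP.
  apply/ffunP => x; rewrite !ffunE; apply/eqP.
  by rewrite -kerfE -eq_blk ptK.
- rewrite inE => /injectiveP c_inj ->.
  rewrite -[RHS](equivalence_partition_pblock partP).
  apply: eq_imset => x; apply/setP => y.
  by rewrite !inE !ffunE (inj_eq c_inj) eq_blk.
Qed.

Lemma card_partition_leq (T : finType) (P : {set {set T}}) (D : {set T}) :
  finset.partition P D -> #|P| <= #|D|.
Proof.
move=> partP; rewrite (card_partition partP) -sum1_card.
by apply: leq_sum => B BP; rewrite card_gt0 (partition_neq0 partP).
Qed.

(** Classify the pairs [(f, r)] by the ordered partition formed by the kernel of
    [f] and [r]: if it has [k] blocks, it arises from [m ^_ k] maps. *)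
Lemma card_fibre_ordered_by_kernel (n m : nat) :
  #|[set fr : {ffun 'I_n -> 'I_m} * {set 'I_n * 'I_n} |
      fibre_ordered fr.1 fr.2]|
  = \sum_(0 <= k < n.+1) lah n k * m ^_ k.
Proof.
pose ker (fr : {ffun 'I_n -> 'I_m} * {set 'I_n * 'I_n}) :=
  (preim_partition fr.1 [set: 'I_n], fr.2).
pose op (Pr : {set {set 'I_n}} * {set 'I_n * 'I_n}) :=
  ordered_partition Pr.1 Pr.2.
have card_le Pr : op Pr -> #|Pr.1| < n.+1.
  case/and3P => partP _ _; rewrite ltnS.
  by rewrite -[X in _ <= X]card_ord -cardsT card_partition_leq.
rewrite -sum1_card (partition_big ker op) /=; last first.
  by move=> fr; rewrite inE /op /= ordered_partition_preim.
transitivity (\sum_(Pr | op Pr) m ^_ #|Pr.1|).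
  apply: eq_bigr => -[P r] opPr; rewrite sum1_card.
  case/and3P: (opPr) => partP _ _.
  rewrite -[in RHS](card_ord m) -(card_ffun_kernel 'I_m partP) /=.
  have inj_r : injective (fun f : {ffun 'I_n -> 'I_m} => (f, r)).
    by move=> f g [].
  rewrite -(card_imset _ inj_r); apply: eq_card => -[f s].
  rewrite [LHS]unfold_in /= inE xpair_eqE /=.
  apply/andP/imsetP => [[_ /andP[kerf /eqP->]]|[g]].
    by exists f; rewrite ?inE.
  rewrite inE => /eqP kerg [-> ->]; rewrite kerg !eqxx.
  by rewrite -ordered_partition_preim kerg.
pose blocks (Pr : {set {set 'I_n}} * {set 'I_n * 'I_n}) : 'I_n.+1 :=
  inord #|Pr.1|.
rewrite big_mkord (partition_big blocks predT) //=.
apply: eq_bigr => k _; rewrite /lah -sum1_card big_distrl /=.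
apply: eq_big => [Pr|Pr /andP[opPr /eqP <-]]; last first.
  by rewrite mul1n inordK ?card_le.
rewrite inE; apply: andb_id2l => opPr.
by rewrite -val_eqE /= inordK ?card_le.
Qed.

(** * Maps with ordered fibres as permutations with weakly increasing words *)

Lemma sorted_tnth m n (t : n.-tuple 'I_m) :
  sorted leq (map val t) =
  [forall i : 'I_n, forall j : 'I_n, (i <= j) ==> (tnth t i <= tnth t j)].
Proof.
have mt (k : 'I_n) : nth 0 (map val t) k = tnth t k.
  by rewrite (nth_map (tnth_default t k)) ?size_tuple // -tnth_nth.
apply/idP/forallP => [st i|mono].
  apply/forallP => j; apply/implyP => ij.
  rewrite -!mt; apply: (sorted_leq_nth leq_trans leqnn 0 st) => //;
    by rewrite inE size_map size_tuple.
apply/(sortedP 0) => i; rewrite size_map size_tuple => in1.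
rewrite (mt (Ordinal (ltnW in1))) (mt (Ordinal in1)).
by have /forallP/(_ (Ordinal in1))/implyP := mono (Ordinal (ltnW in1)); apply.
Qed.

(** The number of weakly increasing words is the binomial coefficient of
    [m + n - 1] over [n]. The empty alphabet is a case of its own because
    [card_sorted_tuples] is about words over ['I_m.+1]. *)
Lemma card_sorted_tuples_rising m n :
  n`! * #|[set t : n.-tuple 'I_m | sorted leq (map val t)]|
  = \prod_(i < n) (m + i).
Proof.
case: m => [|m].
  case: n => [|n]; last first.
    rewrite big_ord_recl mul0n; apply/eqP; rewrite muln_eq0 cards_eq0.
    by apply/orP; right; apply/eqP/setP => t; case: (tnth t ord0).
  rewrite big_ord0 mul1n; apply/eqP/cards1P; exists [tuple].
  by apply/setP => t; rewrite !inE tuple0 eqxx.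
rewrite card_sorted_tuples mulnC bin_ffact.
elim: n => [|n IH]; first by rewrite big_ord0.
by rewrite big_ord_recr /= -IH !addSn ffactSS mulnC [m + n]addnC.
Qed.

Section Rank.
Variables (n : nat) (lt : rel 'I_n).
Hypotheses (lt_irr : irreflexive lt) (lt_trans : transitive lt)
  (lt_total : forall x y, x != y -> lt x y || lt y x).

(** The rank of [x] is the number of elements below it; it is strictly monotone,
    hence injective, hence a permutation. *)
Lemma exists_rank_perm :
  exists s : {perm 'I_n}, forall x y, (s x < s y) = lt x y.
Proof.
pose below x := [set y | lt y x].
have below_lt x : #|below x| < n.
  rewrite -[X in _ < X]card_ord -cardsT proper_card // properT.
  by apply/eqP => /setP/(_ x); rewrite !inE lt_irr.
have mono x y : lt x y -> #|below x| < #|below y|.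
  move=> xy; apply/proper_card/properP; split.
    by apply/fintype.subsetP => z; rewrite !inE => /lt_trans; apply.
  by exists x; rewrite inE ?lt_irr.
pose rank x := Ordinal (below_lt x).
have rank_inj : injective rank.
  move=> x y [xy]; apply/eqP; apply: contraT => /lt_total/orP[] /mono;
    by rewrite xy ltnn.
exists (perm rank_inj) => x y; rewrite !permE /=.
apply/idP/idP => [|/mono//]; apply: contraTT.
have [->|/lt_total/orP[->//|/mono yx] _] := eqVneq x y; first by rewrite ltnn.
by rewrite -leqNgt ltnW.
Qed.

End Rank.

(** A permutation is determined by the total order that it induces, since its
    value at [x] is the number of elements placed before [x]. *)
Lemma perm_lt_inj n (s s' : {perm 'I_n}) :
  (forall x y, (s x < s y) = (s' x < s' y)) -> s = s'.
Proof.
have pos (u : {perm 'I_n}) x : (u x : nat) = #|[set y | u y < u x]|.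
  rewrite -(card_imset _ (@perm_inj _ u)).
  have -> : u @: [set y | u y < u x] = [set z : 'I_n | z < u x].
    apply/setP => z; rewrite -[z](permKV u) mem_imset ?inE //; exact: perm_inj.
  rewrite -sum1dep_card (big_ord_narrow (ltnW (ltn_ord (u x)))).
  by rewrite sum1_card card_ord.
move=> ss'; apply/permP => x; apply: val_inj; rewrite /= (pos s) (pos s').
by apply: eq_card => y; rewrite !inE ss'.
Qed.

(** A permutation [s], read as assigning positions to the elements, and a weakly
    increasing word [t] produce a colouring (the letter at the position of [x])
    and an order on each colour class (by position). Conversely, [(f, r)]
    determines the total order listing the colour classes by increasing colour
    and each class along [r]; [s] is the rank for this order and [t] the list
    of colours along it. *)
Lemma card_fibre_ordered_by_word (n m : nat) :
  #|[set fr : {ffun 'I_n -> 'I_m} * {set 'I_n * 'I_n} |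
      fibre_ordered fr.1 fr.2]|
  = \prod_(i < n) (m + i).
Proof.
rewrite -card_sorted_tuples_rising -card_Sn -cardsT -cardsX.
pose read (st : {perm 'I_n} * n.-tuple 'I_m) :=
  ([ffun x => tnth st.2 (st.1 x)],
   [set p | (tnth st.2 (st.1 p.1) == tnth st.2 (st.1 p.2)) &&
            (st.1 p.1 <= st.1 p.2)]).
rewrite -(card_in_imset (f := read)); last first.
  move=> [s t] [s' t'] /setXP[/= _ +] /setXP[/= _ +]; rewrite !inE !sorted_tnth.
  move=> tmono t'mono [/ffunP ft /setP fr].
  have val x : tnth t (s x) = tnth t' (s' x) by have := ft x; rewrite !ffunE.
  (* The order of the positions can be read off the colours and the orders on
     colour classes. *)
  have ltE (u : {perm 'I_n}) (w : n.-tuple 'I_m) :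
      [forall i : 'I_n, forall j : 'I_n,
        (i <= j) ==> (tnth w i <= tnth w j)] ->
      forall x y, (u x < u y) = (tnth w (u x) < tnth w (u y)) ||
         ~~ ((tnth w (u y) == tnth w (u x)) && (u y <= u x)) &&
         (tnth w (u x) == tnth w (u y)).
    move=> /forallP wm x y.
    have [yx|xy] := leqP (u y) (u x).
      move/(_ (u y))/forallP/(_ (u x)): wm; rewrite yx /= ltnNge => ->.
      by rewrite andbT /= eq_sym andNb.
    move/(_ (u x))/forallP/(_ (u y)): wm; rewrite (ltnW xy) /= => wxy.
    by rewrite andbF /= orbC -val_eqE /= -leq_eqVlt wxy.
  have ss' : s = s'.
    apply: perm_lt_inj => x y; rewrite (ltE s t) // (ltE s' t') // !val.
    by have := fr (y, x); rewrite !inE /= !val => ->.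
  rewrite -ss' in val *; congr (_, _); apply: eq_from_tnth => i.
  by rewrite -[i](permKV s) val.
apply: eq_card => -[f r]; rewrite inE /=; apply/fibre_orderedP/imsetP.
- move=> [tot asym trans].
  (* Lexicographic: by colour, then along [r]. *)
  pose lt x y := (f x < f y) || [&& f x == f y, x != y & (x, y) \in r].
  have eqf x y : (x, y) \in r -> f x = f y.
    by move=> xy; apply/eqP; rewrite tot xy.
  have lt_irr : irreflexive lt.
    by move=> x; rewrite /lt ltnn !eqxx.
  have lt_trans : transitive lt.
    move=> y x z /orP[xy|/and3P[/eqP xy nxy rxy]];
      move=> /orP[yz|/and3P[/eqP yz nyz ryz]]; rewrite /lt.
    + by rewrite (ltn_trans xy yz).
    + by rewrite -yz xy.
    + by rewrite xy yz.
    + rewrite xy yz eqxx (trans _ _ _ rxy ryz) andbT /=; apply/orP; right.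
      apply: contraNneq nxy => xz; rewrite -xz in ryz.
      by rewrite (asym _ _ rxy ryz).
  have lt_total x y : x != y -> lt x y || lt y x.
    move=> nxy; rewrite /lt [y == x]eq_sym nxy /= [f y == f x]eq_sym.
    have [//|//|/val_inj fxy] := ltngtP (f x) (f y); first by rewrite orbT.
    by rewrite fxy eqxx /= -tot fxy.
  have [s sE] := exists_rank_perm lt_irr lt_trans lt_total.
  have [word wordE] :
      exists w : n.-tuple 'I_m, forall i, tnth w i = f (s^-1%g i).
    by exists [tuple f (s^-1%g i) | i < n] => i; rewrite tnth_mktuple.
  exists (s, word).
    rewrite !inE /= sorted_tnth; apply/forallP => i; apply/forallP => j.
    apply/implyP => ij; rewrite !wordE leqNgt; apply: contraL ij => ji.
    by rewrite -ltnNge -[i](permKV s) -[j](permKV s) sE /lt ji.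
  congr (_, _).
    by apply/ffunP => x; rewrite ffunE /= wordE permK.
  apply/setP => -[x y]; rewrite !inE /= !wordE !permK leqNgt sE /lt.
  have [fxy|nfxy] /= := eqVneq (f x) (f y); last first.
    by apply: contraNF nfxy => /eqf ->.
  rewrite fxy ltnn ?eqxx /=; have := tot x y; rewrite fxy eqxx.
  have [->|nxy] := eqVneq y x; first by rewrite orbb => <-.
  case xy : ((x, y) \in r) => /= yx; last by rewrite -yx.
  by apply/esym; apply: contra nxy => yxr; apply/eqP/asym.
- move=> [[s t] /setXP[_ _] [-> ->]].
  split=> [x y|x y|x y z]; rewrite !inE ?ffunE /=.
  + by rewrite [X in _ || (X && _)]eq_sym -andb_orr leq_total andbT.
  + move=> /andP[_ xy] /andP[_ yx]; apply: (@perm_inj _ s); apply: val_inj.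
    by apply/eqP; rewrite eqn_leq xy.
  + by move=> /andP[/eqP-> xy] /andP[-> yz]; apply: leq_trans yz.
Qed.

(** The Lah numbers are the connection coefficients from rising to falling
    factorials. *)
Lemma rising_factorial_lah (n m : nat) :
  \prod_(i < n) (m + i) = \sum_(0 <= k < n.+1) lah n k * m ^_ k.
Proof. by rewrite -card_fibre_ordered_by_word card_fibre_ordered_by_kernel. Qed.

(** * Summation over the number of colours *)

Local Open Scope classical_set_scope.
Local Open Scope ring_scope.

(** The terms with [m < k] vanish and the term of index [m + k] is [1 / m`!]. *)
Lemma cvg_series_ffact (R : realType) (k : nat) :
  series (fun m : nat => (m ^_ k)%:R / m`!%:R : R) @ \oo --> expR (1 : R).
Proof.
rewrite -(cvg_shiftn k) [X in X @ _](_ : _ = series (exp_coeff (1 : R))).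
  exact: is_cvg_series_exp_coeff.
apply/funext => N; rewrite /series /= (big_cat_nat (n := k)) ?leq_addl //=.
rewrite big_nat big1 ?add0r; last first.
  by move=> m /andP[_ mk]; rewrite ffact_small // mul0r.
rewrite -{1}[k]add0n big_addn addnK; apply: eq_bigr => m _.
rewrite /exp_coeff /= expr1n.
have factE : (m + k)`! = ((m + k) ^_ k * m`!)%N.
  by rewrite -(ffact_fact (leq_addl m k)) addnK.
have ffact_neq0 : ((m + k) ^_ k)%:R != 0 :> R.
  by rewrite pnatr_eq0 -lt0n ffact_gt0 leq_addl.
by rewrite factE natrM invfM mulrA divff.
Qed.

Theorem theorem3 (R : realType) (n : nat) :
  cvgn (series (fun k : nat => rising_factorial (k%:R : R) n / k`!%:R)) /\
  (lah_bell n)%:R =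
    (expR 1)^-1 *
    limn (series (fun k : nat => rising_factorial (k%:R : R) n / k`!%:R)).
Proof.
set u := series _.
suff u_cvg : u @ \oo --> (lah_bell n)%:R * expR (1 : R).
  split; first by apply/cvg_ex; exists ((lah_bell n)%:R * expR (1 : R)).
  by rewrite (cvg_lim _ u_cvg) // mulrC mulfK // gt_eqF // expR_gt0.
have -> : u = fun N => \sum_(0 <= k < n.+1) (lah n k)%:R *
            series (fun m : nat => (m ^_ k)%:R / m`!%:R : R) N.
  apply/funext => N; rewrite /u /series /=.
  under [RHS]eq_bigr do rewrite big_distrr.
  rewrite [RHS]exchange_big; apply: eq_bigr => m _ /=.
  have -> : rising_factorial (m%:R : R) n = (\prod_(i < n) (m + i))%N%:R.
    by rewrite natr_prod; apply: eq_bigr => i _; rewrite natrD.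
  rewrite rising_factorial_lah natr_sum mulr_suml.
  by apply: eq_bigr => k _; rewrite natrM mulrA.
rewrite /lah_bell natr_sum mulr_suml.
apply: cvg_big => [|k _]; first exact: add_continuous.
apply: cvgM; [exact: cvg_cst | exact: cvg_series_ffact].
Qed.
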